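(* Let $X$ be a finite simplicial complex, $m\ge 1$, $p$ an odd prime, and let $\alpha^p=\sum_{\sigma\in X^{(m)}}\alpha^p_\sigma\sigma\in C_m(X;\mathbb{F}_p)$ be a cycle. For each $(m-1)$-simplex $\tau$ let $$I_\tau := \{\sigma\in X^{(m)} \mid \alpha^p_\sigma\neq 0 \text{ and } \tau \text{ is a face of } \sigma\}.$$ Suppose there is some $r\in\mathbb{F}_p^*$ such that for every $(m-1)$-simplex $\tau$ and every $\sigma\in I_\tau$, the coefficient $r\alpha^p_\sigma$ lies in $$\mathcal{L}^p_{|I_\tau|-2} = \left\{-\left\lfloor\tfrac{p-1}{|I_\tau|}\right\rfloor,\dots,0,\dots,\left\lfloor\tfrac{p-1}{|I_\tau|}\right\rfloor\right\}.$$ Then $\alpha^p$ can be lifted to a cycle in $C_m(X;\mathbb{Z})$ by scaling and the centered lift. That is, the centered lift $\beta\in C_m(X;\mathbb{Z})$ of $r\alpha^p$ is a cycle, and for an integer $s$ representing $r^{-1}\in\mathbb{F}_p^*$, the chain $s\beta$ is an integer cycle that reduces to $\alpha^p$ modulo $p$.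
   Context: $X^{(j)}$ denotes the set of $j$-simplices of $X$, and $C_m(X;R)$ the simplicial $m$-chains with coefficients in $R$ (with respect to fixed orientations). Centered lift: identify $\mathbb{F}_p$ with $\{0,\dots,p-1\}$. The centered lift of a chain $\sum_\sigma\alpha^p_\sigma\sigma\in C_m(X;\mathbb{F}_p)$ is the integer chain $\sum_\sigma\alpha_\sigma\sigma$ with $\alpha_\sigma=\alpha^p_\sigma$ if $\alpha^p_\sigma\le\frac{p-1}{2}$ and $\alpha_\sigma=\alpha^p_\sigma-p$ if $\alpha^p_\sigma>\frac{p-1}{2}$. An element $x\in\mathbb{F}_p$ is said to lie in a set of integers of the form $\left\{-\left\lfloor\tfrac{p-1}{k}\right\rfloor,\dots,0,\dots,\left\lfloor\tfrac{p-1}{k}\right\rfloor\right\}$, with $k\ge 1$ an integer, if its centered lift (the integer $x$ if $x\le\frac{p-1}{2}$, and $x-p$ if $x>\frac{p-1}{2}$) does. *)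

(* Defs.v *)
From HB Require Import structures.
From mathcomp Require Import all_boot all_order all_fingroup all_algebra.

Set Implicit Arguments.
Unset Strict Implicit.
Unset Printing Implicit Defensive.

Import Order.TTheory GRing.Theory Num.Theory.
Local Open Scope ring_scope.

(* The elements of [V] that lie in no simplex are allowed: the vertex set of
   the complex is the set of [v] such that [set v] is a simplex. *)
Record simplicial_complex (V : finType) := SimplicialComplex {
  simplices :> {set {set V}};
  simplices_neq0 : set0 \notin simplices;
  simplices_closed : forall s t : {set V},
    s \in simplices -> t \subset s -> t != set0 -> t \in simplices
}.

Definition simplex (V : finType) (X : simplicial_complex V) (m : nat) :=
  {s : {set V} | (s \in simplices X) && (#|s| == m.+1)}.

Definition chain (V : finType) (X : simplicial_complex V) (m : nat)
    (R : nzRingType) :=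
  {ffun simplex X m -> R^o}.

(* An orientation of a simplex is given by an ordering of its vertices, of
   which only the class modulo even permutations matters geometrically.  Since
   an m-simplex has m.+1 vertices, [vertex_orderP] forces the tuple to be
   duplicate-free. *)
Record orientation (V : finType) (X : simplicial_complex V) := Orientation {
  vertex_order : forall m, simplex X m -> m.+1.-tuple V;
  vertex_orderP : forall m (s : simplex X m),
    [set x in vertex_order s] = val s
}.
Arguments vertex_order {V X} o {m} s.

Section Boundary.
Variables (V : finType) (X : simplicial_complex V) (o : orientation X).

(* Coefficient of the oriented simplex [t] in the boundary
   \sum_i (-1)^i [v_0, ..., v_(i-1), v_(i+1), ..., v_(m+1)] of
   s = [v_0, ..., v_(m+1)].  If the i-th face has the vertices of [t], it is
   [t] reordered by a unique permutation [pi], hence (-1)^pi times [t];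
   otherwise the inner sum is empty. *)
Definition incidence (m : nat) (s : simplex X m.+1) (t : simplex X m) : int :=
  \sum_(i < m.+2)
    \sum_(pi : 'S_m.+1 |
          [forall j, tnth (vertex_order o s) (lift i j) == tnth (vertex_order o t) (pi j)])
      (-1) ^+ i * (-1) ^+ pi.

Definition boundary (R : nzRingType) (m : nat) (c : chain X m.+1 R) :
    chain X m R :=
  [ffun t => \sum_(s : simplex X m.+1) c s * (incidence s t)%:~R].

Definition is_cycle (R : nzRingType) (m : nat) (c : chain X m.+1 R) : Prop :=
  boundary c = 0.

End Boundary.

(* For [p] prime, the coercion of [x : 'F_p] to nat is its representative in
   {0, ..., p - 1}. *)
Definition centered_lift (p : nat) (x : 'F_p) : int :=
  if (x <= p.-1./2)%N then x%:Z else x%:Z - p%:Z.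

Definition lift_chain (V : finType) (X : simplicial_complex V) (m p : nat)
    (c : chain X m 'F_p) : chain X m int :=
  [ffun s => centered_lift (c s)].

Definition reduce_chain (V : finType) (X : simplicial_complex V) (m p : nat)
    (c : chain X m int) : chain X m 'F_p :=
  [ffun s => (c s)%:~R].

(* The set {-floor((p-1)/k), ..., floor((p-1)/k)}, for k >= 1; it is indexed by
   the divisor k rather than by k - 2. *)
Definition coef_range (p k : nat) : interval int :=
  `[- (p.-1 %/ k)%N%:Z, (p.-1 %/ k)%N%:Z].

Definition in_coef_range (p k : nat) (x : 'F_p) : bool :=
  centered_lift x \in coef_range p k.

Definition incident_support (V : finType) (X : simplicial_complex V)
    (m p : nat) (a : chain X m.+1 'F_p) (t : simplex X m) :
    {set simplex X m.+1} :=
  [set s | (a s != 0) && (val t \subset val s)].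

(* Main.v *)
(* The coefficient of the boundary of the centered lift at tau is divisible by p,
   since the boundary commutes with reduction modulo p. It is a sum of at most
   k = |I_tau| nonzero terms, each of absolute value at most floor((p-1)/k)
   because incidence numbers lie in {-1, 0, 1}; so its absolute value is less
   than p, and it vanishes. *)
Require Import Defs.
From mathcomp Require Import all_boot all_order all_fingroup all_algebra.

Import Order.TTheory GRing.Theory Num.Theory.
Local Open Scope ring_scope.

Section Incidence.
Variables (V : finType) (X : simplicial_complex V) (o : orientation X).

Lemma mem_vertex_order (m : nat) (s : simplex X m) (x : V) :
  (x \in vertex_order o s) = (x \in val s).
Proof. by rewrite -(vertex_orderP o s) inE. Qed.

Lemma vertex_order_inj (m : nat) (s : simplex X m) :
  injective (tnth (vertex_order o s)).
Proof.
apply/tuple_uniqP/card_uniqP; rewrite size_tuple.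
have /andP[_ /eqP card_s] := valP s; rewrite -[RHS]card_s.
by apply: eq_card => x; rewrite mem_vertex_order.
Qed.

(** The index pairs of the double sum in [incidence], gathered into one set so that bounding an
    incidence number becomes a counting problem. *)
Definition face_matching {m : nat} (s : simplex X m.+1) (t : simplex X m) :
    {set 'I_m.+2 * 'S_m.+1} :=
  [set ip : 'I_m.+2 * 'S_m.+1 |
     [forall j, tnth (vertex_order o s) (lift ip.1 j)
                == tnth (vertex_order o t) (ip.2 j)]].

Lemma incidenceE (m : nat) (s : simplex X m.+1) (t : simplex X m) :
  incidence o s t =
    \sum_(ip in face_matching s t) (-1) ^+ ip.1 * (-1) ^+ ip.2.
Proof.
rewrite /incidence pair_big_dep /=.
by apply: eq_bigl => ip; rewrite inE.
Qed.

(** Since vertices of a simplex are listed without repetition, [t] determines which vertex of [s] is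
    omitted, and then the permutation. *)
Lemma face_matching_le1 (m : nat) (s : simplex X m.+1) (t : simplex X m) :
  (#|face_matching s t| <= 1)%N.
Proof.
apply/card_le1_eqP => -[i pi] [k pk].
rewrite !inE /= => /forallP /= Hi /forallP /= Hk.
have eq_ik : i = k.
  (* If [i] differs from [k], vertex [i] of [s] survives in the face omitting vertex [k], so it
     belongs to [t], hence to the face omitting vertex [i] itself: a contradiction. *)
  case: (unliftP k i) => [j ij|//].
  have := eqP (Hk j); rewrite -ij -(permKV pi (pk j)) -(eqP (Hi _)).
  by move/vertex_order_inj/eqP; rewrite (negbTE (neq_lift _ _)).
subst k; congr (_, _); apply/permP => j; apply: (@vertex_order_inj _ t).
by rewrite -(eqP (Hi j)) (eqP (Hk j)).
Qed.

(** Each term is a product of signs, so the norm is at most the number of matchings. *)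
Lemma normr_incidence_le1 (m : nat) (s : simplex X m.+1) (t : simplex X m) :
  `|incidence o s t| <= 1.
Proof.
rewrite incidenceE; apply: le_trans (ler_norm_sum _ _ _) _.
under eq_bigr do rewrite normrM !normrX normrN1 !expr1n mulr1.
by rewrite sumr_const natz (lez_nat _ 1) face_matching_le1.
Qed.

(** Any matching would exhibit every vertex of [t] as a vertex of [s], so the sum is empty. *)
Lemma incidence_eq0 (m : nat) (s : simplex X m.+1) (t : simplex X m) :
  ~~ (val t \subset val s) -> incidence o s t = 0.
Proof.
move=> ts; rewrite incidenceE big1 // => -[i pi]; rewrite inE => /forallP /= H.
case/negP: ts; apply/subsetP => x; rewrite -!mem_vertex_order => /tnthP[j ->].
by rewrite -(permKV pi j) -(eqP (H _)) mem_tnth.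
Qed.

Lemma boundaryZ (R : comNzRingType) (m : nat) (a : R) (c : chain X m.+1 R) :
  boundary o (a *: c) = a *: boundary o c.
Proof.
apply/ffunP => t; rewrite !ffunE scaler_sumr.
by apply: eq_bigr => s _; rewrite ffunE /= scalerAl.
Qed.

Lemma is_cycleZ (R : comNzRingType) (m : nat) (a : R) (c : chain X m.+1 R) :
  is_cycle o c -> is_cycle o (a *: c).
Proof. by rewrite /is_cycle boundaryZ => ->; rewrite scaler0. Qed.

End Incidence.

Section CenteredLift.
Variables (p : nat) (p_prime : prime p).

Lemma centered_lift0 : centered_lift (0 : 'F_p) = 0.
Proof. by []. Qed.

Lemma centered_liftK (x : 'F_p) : (centered_lift x)%:~R = x.
Proof.
rewrite /centered_lift; case: ifP => _; rewrite ?intrB -!pmulrn ?natr_Zp //.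
by rewrite pchar_Fp_0 // subr0.
Qed.

Lemma intr_Fp_eq0 (z : int) : (z%:~R == 0 :> 'F_p) = (p %| `|z|)%N.
Proof.
rewrite (dvdn_pcharf (pchar_Fp p_prime)) pmulrn abszE.
by case: ger0P => // _; rewrite rmorphN oppr_eq0.
Qed.

Lemma intr_Fp_inj_small (z : int) : `|z| < p%:Z -> z%:~R = 0 :> 'F_p -> z = 0.
Proof.
rewrite -abszE ltz_nat => zp /eqP; rewrite intr_Fp_eq0 => pz.
apply/eqP; rewrite -absz_eq0 -leqn0 leqNgt; apply/negP => z0.
by have := dvdn_leq z0 pz; rewrite leqNgt zp.
Qed.

Variables (V : finType) (X : simplicial_complex V) (o : orientation X).

Lemma boundary_lift_chain (m : nat) (c : chain X m.+1 'F_p) (t : simplex X m) :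
  (boundary o (lift_chain c) t)%:~R = boundary o c t.
Proof.
rewrite !ffunE rmorph_sum; apply: eq_bigr => s _.
by rewrite ffunE rmorphM /= intz centered_liftK.
Qed.

Lemma normr_boundary_lift_chain (m : nat) (c : chain X m.+1 'F_p)
    (t : simplex X m) :
  (forall s, s \in incident_support c t ->
     in_coef_range #|incident_support c t| (c s)) ->
  `|boundary o (lift_chain c) t| < p%:Z.
Proof.
move=> c_range; rewrite ffunE.
set I := incident_support c t in c_range *.
(* A simplex outside [I] contributes nothing: either its coefficient is zero, or [t] is not one of
   its faces and the incidence number vanishes. *)
rewrite (bigID [in I]) /= [X in _ + X]big1 ?addr0; last first.
  move=> s; rewrite inE negb_and negbK ffunE => /orP[/eqP->|ts].
    by rewrite centered_lift0 mul0r.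
  by rewrite incidence_eq0 ?mulr0.
apply: le_lt_trans (ler_norm_sum _ _ _) _.
apply: (@le_lt_trans _ _ (\sum_(s in I) (p.-1 %/ #|I|)%N%:Z)).
  apply: ler_sum => s sI; rewrite ffunE normrM intz -[leRHS]mulr1.
  apply: ler_pM => //; last exact: normr_incidence_le1.
  by rewrite ler_norml; have := c_range s sI; rewrite /in_coef_range in_itv.
(* The bound is now the floor of [(p-1)/#|I|] times [#|I|], which is at most [p-1]. This includes
   empty [I], where the product is 0. *)
rewrite sumr_const -mulr_natr natz -PoszM ltz_nat.
by rewrite (leq_ltn_trans (leq_divM _ _)) // ltn_predL prime_gt0.
Qed.

Lemma is_cycle_lift_chain (m : nat) (c : chain X m.+1 'F_p) :
  is_cycle o c ->
  (forall (t : simplex X m) (s : simplex X m.+1), s \in incident_support c t ->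
     in_coef_range #|incident_support c t| (c s)) ->
  is_cycle o (lift_chain c).
Proof.
move=> c_cycle c_range; apply/ffunP => t; rewrite [RHS]ffunE.
apply: intr_Fp_inj_small; first exact/normr_boundary_lift_chain/c_range.
by rewrite boundary_lift_chain c_cycle ffunE.
Qed.

Lemma incident_supportZ (m : nat) (a : 'F_p) (c : chain X m.+1 'F_p)
    (t : simplex X m) :
  a != 0 -> incident_support (a *: c) t = incident_support c t.
Proof.
by move=> a0; apply/setP => s; rewrite !inE ffunE mulf_eq0 (negbTE a0).
Qed.

End CenteredLift.

Theorem corollary4p5 (V : finType) (X : simplicial_complex V)
    (o : orientation X) (m p : nat) (p_prime : prime p) (p_odd : odd p)
    (alpha : chain X m.+1 'F_p) (alpha_cycle : is_cycle o alpha)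
    (r : 'F_p) (r_neq0 : r != 0)
    (r_range : forall (tau : simplex X m) (sigma : simplex X m.+1),
       sigma \in incident_support alpha tau ->
       in_coef_range #|incident_support alpha tau| (r * alpha sigma)) :
  let beta := lift_chain (r *: alpha) in
  is_cycle o beta /\
  forall s : int, s%:~R = r^-1 ->
    is_cycle o (s *: beta) /\ reduce_chain p (s *: beta) = alpha.
Proof.
move=> beta; have beta_cycle : is_cycle o beta.
  apply: is_cycle_lift_chain => // [|t s]; first exact: is_cycleZ.
  (* Scaling by the unit [r] leaves every [I_tau] unchanged, so the range hypothesis, whose divisor
     counts the support of [alpha], applies to [r *: alpha]. *)
  by rewrite incident_supportZ // ffunE; apply: r_range.
split=> // s sr; split; first exact: is_cycleZ.
(* Modulo [p], [s] becomes [r^-1] and [beta] becomes [r *: alpha], so the scalars cancel. *)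
apply/ffunP => x; rewrite !ffunE rmorphM /= sr centered_liftK //.
by rewrite mulrA mulVf // mul1r.
Qed.
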